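(* Let $X$ be an infinite set and let $S$ be a Boolean monoid that is a wide inverse submonoid of the symmetric inverse monoid $I(X)$. Then either $S$ has an invariant mean or $S$ is strongly paradoxical.
   Context: An inverse semigroup is a semigroup $S$ in which every $a$ has a unique $a^{-1}$ with $a=aa^{-1}a$ and $a^{-1}=a^{-1}aa^{-1}$; all inverse semigroups here have a zero $0$. $E(S)$ is the set of idempotents (a meet-semilattice under multiplication). The natural partial order is $a\le b$ iff $a=be$ for some $e\in E(S)$; joins $\vee$ are taken in this order. Elements $a,b$ are compatible if $a^{-1}b$ and $ab^{-1}$ are idempotents, and orthogonal ($a\perp b$) if $a^{-1}b=ab^{-1}=0$. An inverse semigroup with zero is distributive if every compatible pair has a join and multiplication distributes over such joins; it is a Boolean semigroup if moreover $E(S)$ is a (generalized) Boolean algebra, and a Boolean monoid if it is also a monoid (then $E(S)$ is a Boolean algebra with top $1$). Write $\mathbf{d}(a)=a^{-1}a$ and $\mathbf{r}(a)=aa^{-1}$. $I(X)$ is the inverse monoid of all partial bijections of $X$ (bijections between subsets of $X$) under composition; its idempotents are the identity maps $1_A$ on subsets $A\subseteq X$. An inverse submonoid is wide if it contains all the idempotents of the larger monoid. An invariant mean on a Boolean monoid $S$ is a function $\mu:E(S)\to[0,\infty)$ such that $\mu(s^{-1}s)=\mu(ss^{-1})$ for all $s\in S$; $\mu(e\vee f)=\mu(e)+\mu(f)$ for all orthogonal idempotents $e,f$; and $\mu(1)=1$. A Boolean monoid $S$ is strongly paradoxical if there are $a,b\in S$ with $\mathbf{d}(a)=1=\mathbf{d}(b)$,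 $\mathbf{r}(a)\perp\mathbf{r}(b)$ and $\mathbf{r}(a)\vee\mathbf{r}(b)=1$. *)

(* Defs.v *)
From HB Require Import structures.
From mathcomp Require Import all_boot all_order all_algebra.
From mathcomp Require Import all_classical all_reals.

Set Implicit Arguments.
Unset Strict Implicit.
Unset Printing Implicit Defensive.

Local Open Scope classical_set_scope.
Local Open Scope group_scope.

(* Inverse monoids with zero.  The laws inherited from [starMonoidType],
   namely (a^-1)^-1 = a and (a * b)^-1 = b^-1 * a^-1, hold in every inverse
   semigroup, so building on them does not restrict the notion. *)
HB.mixin Record isInverseMonoid S of StarMonoid S := {
  mzero : S;
  mul0m : forall a : S, mzero * a = mzero;
  mulm0 : forall a : S, a * mzero = mzero;
  mulmVm : forall a : S, a = a * a^-1 * a;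
  mulVmV : forall a : S, a^-1 = a^-1 * a * a^-1;
  invm_uniq : forall a b : S, a = a * b * a -> b = b * a * b -> b = a^-1
}.

#[short(type="inverseMonoidType")]
HB.structure Definition InverseMonoid := {S of isInverseMonoid S & StarMonoid S}.

Section InverseMonoidNotions.
Variable S : inverseMonoidType.
Implicit Types a b c j : S.

Definition idempotents : set S := [set e | e * e = e].

Definition natle a b : Prop := exists2 e, idempotents e & a = b * e.

Definition is_join a b j : Prop :=
  [/\ natle a j, natle b j & forall c, natle a c -> natle b c -> natle j c].

Definition compatible a b : Prop :=
  idempotents (a^-1 * b) /\ idempotents (a * b^-1).

Definition orthogonal a b : Prop := a^-1 * b = mzero /\ a * b^-1 = mzero.

Definition dom a : S := a^-1 * a.
Definition ran a : S := a * a^-1.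

Definition distributive_monoid : Prop :=
  (forall a b, compatible a b -> exists j, is_join a b j) /\
  (forall a b j c, compatible a b -> is_join a b j ->
     is_join (c * a) (c * b) (c * j) /\ is_join (a * c) (b * c) (j * c)).

(* The poset of idempotents is isomorphic to a sectionally complemented
   distributive lattice with bottom, i.e. a generalized Boolean algebra. *)
Definition idempotents_boolean : Prop :=
  exists (d : Order.disp_t) (B : cbDistrLatticeType d) (phi : B -> S),
    [/\ injective phi, range phi = idempotents &
        forall x y : B, (x <= y)%O <-> natle (phi x) (phi y)].

Definition boolean_monoid : Prop := distributive_monoid /\ idempotents_boolean.

Definition strongly_paradoxical : Prop :=
  exists a b : S, [/\ dom a = 1, dom b = 1, orthogonal (ran a) (ran b) &
                      is_join (ran a) (ran b) 1].

(* [mu] is defined on the subtype of idempotents, hence the equations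
   relating its arguments to elements of [S]. *)
Definition invariant_mean (R : realType) (mu : idempotents -> R) : Prop :=
  [/\ forall e : idempotents, (0 <= mu e)%R,
      forall (s : S) (e f : idempotents),
        \val e = dom s -> \val f = ran s -> mu e = mu f,
      forall e f g : idempotents, orthogonal (\val e) (\val f) ->
        is_join (\val e) (\val f) (\val g) -> mu g = (mu e + mu f)%R &
      forall e : idempotents, \val e = 1 -> mu e = 1%R].

End InverseMonoidNotions.

Arguments idempotents : clear implicits.

Record wideInvSubmonoid (M : inverseMonoidType) := WideInvSubmonoid {
  wis_carrier : set M;
  wis_one : wis_carrier 1;
  wis_mul : forall a b, wis_carrier a -> wis_carrier b -> wis_carrier (a * b);
  wis_inv : forall a, wis_carrier a -> wis_carrier a^-1;
  wis_wide : idempotents M `<=` wis_carrier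
}.

Definition wis_type (M : inverseMonoidType) (S : wideInvSubmonoid M) : Type :=
  set_type (wis_carrier S).
Coercion wis_type : wideInvSubmonoid >-> Sortclass.

Section WideInvSubmonoid.
Variables (M : inverseMonoidType) (S : wideInvSubmonoid M).

HB.instance Definition _ := Choice.copy (wis_type S) (set_type (wis_carrier S)).

Definition wis_val (a : S) : M := \val (a : set_type (wis_carrier S)).

Definition wis_sub (a : M) (aS : wis_carrier S a) : S := SigSub (mem_set aS).

Lemma wis_valP (a : S) : wis_carrier S (wis_val a).
Proof. exact: set_mem (valP (a : set_type (wis_carrier S))). Qed.

Lemma wis_val_inj : injective wis_val.
Proof. exact: (@val_inj _ _ (set_type (wis_carrier S))). Qed.

Lemma wis_subK (a : M) (aS : wis_carrier S a) : wis_val (wis_sub aS) = a.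
Proof. by []. Qed.

Lemma wis_zero : wis_carrier S mzero.
Proof. by apply: wis_wide; rewrite /idempotents /= mul0m. Qed.

Definition sub_one : S := wis_sub (wis_one S).
Definition sub_zero : S := wis_sub wis_zero.
Definition sub_mul (a b : S) : S := wis_sub (wis_mul (wis_valP a) (wis_valP b)).
Definition sub_inv (a : S) : S := wis_sub (wis_inv (wis_valP a)).

Lemma sub_mulA : associative sub_mul.
Proof. by move=> a b c; apply: wis_val_inj; rewrite !wis_subK mulgA. Qed.
Lemma sub_mul1 : left_id sub_one sub_mul.
Proof. by move=> a; apply: wis_val_inj; rewrite !wis_subK mul1g. Qed.

Lemma sub_invK : involutive sub_inv.
Proof. by move=> a; apply: wis_val_inj; rewrite !wis_subK invgK. Qed.
Lemma sub_invM : {morph sub_inv : a b / sub_mul a b >-> sub_mul b a}.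
Proof. by move=> a b; apply: wis_val_inj; rewrite !wis_subK invgM. Qed.

HB.instance Definition _ :=
  isStarMonoid.Build (wis_type S) sub_mulA sub_mul1 sub_invK sub_invM.

Lemma sub_mul0 (a : S) : sub_zero * a = sub_zero.
Proof. by apply: wis_val_inj; rewrite !wis_subK mul0m. Qed.
Lemma sub_mulr0 (a : S) : a * sub_zero = sub_zero.
Proof. by apply: wis_val_inj; rewrite !wis_subK mulm0. Qed.
Lemma sub_mulmVm (a : S) : a = a * a^-1 * a.
Proof. by apply: wis_val_inj; rewrite !wis_subK -mulmVm. Qed.
Lemma sub_mulVmV (a : S) : a^-1 = a^-1 * a * a^-1.
Proof. by apply: wis_val_inj; rewrite !wis_subK -mulVmV. Qed.
Lemma sub_invm_uniq (a b : S) : a = a * b * a -> b = b * a * b -> b = a^-1.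
Proof.
move=> /(congr1 wis_val); rewrite !wis_subK => aba.
move=> /(congr1 wis_val); rewrite !wis_subK => bab.
by apply: wis_val_inj; rewrite wis_subK; apply: invm_uniq.
Qed.

HB.instance Definition _ := isInverseMonoid.Build (wis_type S)
  sub_mul0 sub_mulr0 sub_mulmVm sub_mulVmV sub_invm_uniq.

End WideInvSubmonoid.

(* A partial bijection of X, given by its graph. *)
Record pbij (X : Type) := PBij {
  graph : set (X * X);
  graph_fun : forall x y z, graph (x, y) -> graph (x, z) -> y = z;
  graph_inj : forall x y z, graph (x, z) -> graph (y, z) -> x = y
}.

Section SymmetricInverseMonoid.
Variable X : Type.
Implicit Types f g h : pbij X.

HB.instance Definition _ := gen_eqMixin (pbij X).
HB.instance Definition _ := gen_choiceMixin (pbij X).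

Lemma pbijP f g : (forall x y, graph f (x, y) <-> graph g (x, y)) -> f = g.
Proof.
move=> fg; have {}fg : graph f = graph g.
  by apply/seteqP; split=> -[x y] /fg.
case: f g fg => [F p q] [G p' q'] /= FG; case: _ / FG p' q' => p' q'.
by rewrite (Prop_irrelevance p p') (Prop_irrelevance q q').
Qed.

Definition pbij_id_on (A : set X) : pbij X.
Proof. by exists [set xy | A xy.1 /\ xy.1 = xy.2] => x y z /= [_ ->] [_ ->]. Defined.

(* f after g, so that f^-1 * f is the identity on the domain of f. *)
Definition pbij_comp f g : pbij X.
Proof.
exists [set xy | exists2 u, graph g (xy.1, u) & graph f (u, xy.2)] =>
  x y z /= [u gu fu] [v gv fv].
  by move: fv; rewrite -(graph_fun gu gv); apply: graph_fun.
by apply: graph_inj gu _; rewrite (graph_inj fu fv).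
Defined.

Definition pbij_inv f : pbij X.
Proof.
by exists [set xy | graph f (xy.2, xy.1)] => x y z /=; [apply: graph_inj|apply: graph_fun].
Defined.

Lemma pbij_compA : associative pbij_comp.
Proof.
move=> f g h; apply: pbijP => x y; split=> /=.
  by move=> [u [v hv gu] fu]; exists v => //; exists u.
by move=> [v hv [u gu fu]]; exists u => //; exists v.
Qed.

Lemma pbij_comp1f : left_id (pbij_id_on setT) pbij_comp.
Proof.
move=> f; apply: pbijP => x y; split=> /=; first by move=> [u fu [_ <-]].
by move=> fxy; exists y.
Qed.

Lemma pbij_invK : involutive pbij_inv.
Proof. by move=> f; apply: pbijP => x y. Qed.

Lemma pbij_invM : {morph pbij_inv : f g / pbij_comp f g >-> pbij_comp g f}.
Proof. by move=> f g; apply: pbijP => x y; split=> /= -[u fu gu]; exists u. Qed.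

HB.instance Definition _ :=
  isStarMonoid.Build (pbij X) pbij_compA pbij_comp1f pbij_invK pbij_invM.

Lemma pbij_comp0f f : pbij_id_on set0 * f = pbij_id_on set0.
Proof. by apply: pbijP => x y; split=> /=; [move=> [u _ []]|case]. Qed.

Lemma pbij_compf0 f : f * pbij_id_on set0 = pbij_id_on set0.
Proof. by apply: pbijP => x y; split=> /=; [move=> [u []]|case]. Qed.

Lemma pbij_compfVf f : f = f * f^-1 * f.
Proof.
apply: pbijP => x y; split=> /= [fxy|[u fu [v fv fvy]]].
  by exists y => //; exists x.
by rewrite (graph_inj fu fv).
Qed.

Lemma pbij_compVfV f : f^-1 = f^-1 * f * f^-1.
Proof.
apply: pbijP => x y; split=> /= [fxy|[u fu [v fv fvy]]].
  by exists y => //; exists x.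
by rewrite (graph_fun fu fv).
Qed.

Lemma pbij_inv_uniq f g : f = f * g * f -> g = g * f * g -> g = f^-1.
Proof.
move=> /(congr1 (@graph X)) fE /(congr1 (@graph X)) gE.
apply: pbijP => x y; split=> /= xy.
  have : graph (g * f * g) (x, y) by rewrite -gE.
  move=> [u /= gxu [v /= fuv gvy]]; move: fuv.
  by rewrite (graph_fun xy gxu) (graph_inj xy gvy).
have : graph (f * g * f) (y, x) by rewrite -fE.
move=> [u /= fyu [v /= guv fvx]]; move: guv.
by rewrite (graph_fun xy fyu) (graph_inj xy fvx).
Qed.

HB.instance Definition _ := isInverseMonoid.Build (pbij X)
  pbij_comp0f pbij_compf0 pbij_compfVf pbij_compVfV pbij_inv_uniq.

End SymmetricInverseMonoid.

(* Main.v *)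
Require Import Defs.
From mathcomp Require Import all_boot all_order all_algebra.
From mathcomp Require Import finmap zify.
From mathcomp Require Import all_classical all_reals.
From mathcomp Require Import topology normedtype.

(** The proof replaces Tarski's type semigroup by counting in finite sets of
points, in the manner of Folner.  For a finite subset K of S and a finite
subset F of X, let K F be the set of all images of points of F under elements
of K.  There are two cases.

Suppose that some finite K in S satisfies |K F| >= 2 |F| for all finite F.  By
Hall's theorem for infinite, locally finite bipartite graphs ([infinite_hall]),
two copies of X can be matched into X along K.  This gives two injections of X
into itself with disjoint ranges, each agreeing at every point with one of the
finitely many elements of K.  Such a map belongs to S, because S is wide and
has joins of compatible pairs ([wis_piecewise]).  A Schroeder--Bernstein
argument then makes the ranges cover X, so S is strongly paradoxical
([strongly_paradoxical_of_doubling]).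

Suppose that there is no such K.  Since a set that expands all finite sets by a
fixed factor greater than 1 has a power that doubles them
([expansion_doubling]), no K expands: for all s_1, ..., s_k in S and every m
there is a nonempty finite F with |s_i F \ F| <= |F| / m for each i
([exists_almost_invariant]).  The relative frequency |A /\ F| / |F| of a set A
in F is additive in A, and it nearly agrees for A = dom s_i and A = ran s_i.
Its limit along an ultrafilter of such F is an invariant mean
([invariant_mean_mean]). *)

Set Implicit Arguments.
Unset Strict Implicit.
Unset Printing Implicit Defensive.

Import Order.TTheory GRing.Theory Num.Theory.
Import numFieldNormedType.Exports.

Local Open Scope classical_set_scope.

(** * Hall's theorem for finite systems *)

Section Hall.
Variables (I J : choiceType).
Implicit Types (N : I -> {fset J}) (A B C : {fset I}).
Local Open Scope fset_scope.

Definition nbhd N B : {fset J} := \bigcup_(i <- B) N i.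

Lemma nbhdP N B y : reflect (exists2 i, i \in B & y \in N i) (y \in nbhd N B).
Proof.
apply: (iffP (bigfcupP _ _ _ _)) => -[i]; first by rewrite andbT; exists i.
by exists i => //; rewrite andbT.
Qed.

Definition hall_condition N A :=
  forall B, B `<=` A -> (#|` B| <= #|` nbhd N B|)%N.

Definition matching N A (f : I -> J) :=
  {in A, forall i, f i \in N i} /\ {in A &, injective f}.

(** Matching the vertices of [B] into [Y] leaves [Y] blocked for the others; a
matching of the rest that avoids [Y] can be put next to it.  Both cases of the
induction below end with this step. *)
Lemma matching_glue N A B (Y : {fset J}) f g :
  matching N B f -> {in B, forall i, f i \in Y} ->
  matching (fun i => N i `\` Y) (A `\` B) g ->
  matching N A (fun i => if i \in B then f i else g i).
Proof.
move=> [fN finj] fY [gN ginj].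
have gY i : i \in A -> i \notin B -> g i \in N i /\ g i \notin Y.
  move=> iA iB; have := gN i; rewrite in_fsetD iA iB => /(_ isT).
  by rewrite in_fsetD => /andP[].
split=> [i iA|i j iA jA].
  by case: ifPn => [/fN//|/(gY i iA)[]].
case: ifPn => iB; case: ifPn => jB.
- exact: finj.
- by move=> e; have [_] := gY j jA jB; rewrite -e fY.
- by move=> e; have [_] := gY i iA iB; rewrite e fY.
- by apply: ginj; rewrite in_fsetD ?iA ?jA ?iB ?jB.
Qed.

(** The Halmos--Vaughan induction.  If a proper nonempty [B] is tight, meaning
that it has exactly as many neighbours as elements, then [B] can be matched by
itself, and the rest still satisfies Hall's condition after the neighbours of
[B] are deleted, since a violation by [C] would be one by the union of [B] and
[C].  If no such [B] is tight, every proper nonempty set has a neighbour to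
spare, so one vertex can be matched arbitrarily.  The point [j0] gives a value
outside [A]. *)
Lemma hall_marriage (j0 : J) N A :
  hall_condition N A -> exists f, matching N A f.
Proof.
have [n] := ubnP #|` A|; elim: n N A => // n IH N A /ltnSE leAn hallA.
have [->|/fset0Pn[a aA]] := eqVneq A fset0.
  by exists (fun=> j0); split=> i; rewrite in_fset0.
have [[B [BA B0 eqB]]|strict] := pselect (exists B,
    [/\ B `<` A, B != fset0 & #|` nbhd N B| = #|` B|]).
  have sBA := fproper_sub BA.
  have [f [fN finj]] : exists f, matching N B f.
    apply: IH; first exact: leq_trans (fproper_ltn_card BA) leAn.
    by move=> C CB; apply: hallA; apply: fsubset_trans CB sBA.
  have [g gM] : exists g, matching (fun i => N i `\` nbhd N B) (A `\` B) g.
    apply: IH; first by rewrite (leq_trans _ leAn)// cardfsDS// ltn_subrL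
       !cardfs_gt0 B0; apply/fset0Pn; exists a.
    move=> C /fsubsetDP[CA]; rewrite fdisjoint_sym => BC.
    have := hallA (B `|` C); rewrite fsubUset sBA CA => /(_ isT).
    rewrite cardfsU (disjoint_fsetI0 BC) cardfs0 subn0 => BCN.
    rewrite -(leq_add2l #|` B|) (leq_trans BCN)// -eqB.
    apply: leq_trans (leq_card_fsetU _ _).
    apply: fsubset_leq_card; apply/fsubsetP => y /nbhdP[i + yi].
    rewrite in_fsetU => /orP[iB|iC]; first by rewrite in_fsetU; apply/orP;
      left; apply/nbhdP; exists i.
    rewrite in_fsetU; have [//|yB /=] := boolP (y \in nbhd N B).
    by apply/nbhdP; exists i => //; rewrite in_fsetD yB.
  exists (fun i => if i \in B then f i else g i); apply: matching_glue gM => //.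
  by move=> i iB; apply/nbhdP; exists i => //; apply: fN.
have /fset0Pn[y /nbhdP[_ /fset1P-> yNa]] : nbhd N [fset a] != fset0.
  by rewrite -cardfs_gt0 (leq_trans _ (hallA _ _)) ?cardfs1 ?fsub1set.
have [g gM] : exists g, matching (fun i => N i `\` [fset y]) (A `\` [fset a]) g.
  apply: IH.
    by rewrite (leq_trans _ leAn)// (cardfsD1 a A) aA.
  move=> C CAa; have [->|C0] := eqVneq C fset0; first by rewrite cardfs0.
  have CA : C `<` A.
    by apply: fsub_proper_trans CAa _; rewrite fproperD1.
  have : (#|` C| < #|` nbhd N C|)%N.
    rewrite ltn_neqAle hallA ?fproper_sub// andbT; apply/eqP => eqC.
    by apply: strict; exists C.
  move=> ltC; rewrite -ltnS (leq_trans ltC)//.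
  have -> : nbhd (fun i => N i `\` [fset y]) C = nbhd N C `\ y.
    apply/fsetP => z; rewrite in_fsetD1; apply/nbhdP/andP.
      by move=> [i iC]; rewrite in_fsetD1 => /andP[zy zi]; split=> //;
        apply/nbhdP; exists i.
    by move=> [zy /nbhdP[i iC zi]]; exists i => //; rewrite in_fsetD1 zy.
  by rewrite (cardfsD1 y (nbhd N C)) -add1n leq_add2r leq_b1.
exists (fun i => if i \in [fset a] then y else g i).
apply: matching_glue gM => [|i _]; last exact: fset11.
by split=> [i|i j] /fset1P-> // /fset1P->.
Qed.
End Hall.

(** * Ultrafilters and Hall's theorem for infinite systems *)

(** Compactness in terms of ultrafilters: conditions that are satisfiable
finitely many at a time hold together along an ultrafilter.  This turns finite
matchings into an infinite one, and almost invariant finite sets into an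
invariant mean. *)
Lemma ultrafilter_of_finI (T : choiceType) (I : Type) (P : T -> set I) :
  (forall K : {fset T}, exists i, {in K, forall t, P t i}) ->
  exists U : set_system I, UltraFilter U /\ forall t, U (P t).
Proof.
move=> finP.
have FP : ProperFilter (filter_from (finI_from setT P) id).
  by apply: finI_filter => K _; have [i Ki] := finP K; exists i => t /Ki.
have [U [UU sU]] := ultraFilterLemma FP; exists U; split=> // t.
by apply: sU; exists (P t) => //; exact: finI_from1.
Qed.

Lemma ultrafilter_seq (I : Type) (J : eqType) (U : set_system I) (f : I -> J)
    (s : seq J) : UltraFilter U -> U [set c | f c \in s] ->
  exists2 y, y \in s & U [set c | f c = y].
Proof.
move=> UU; elim: s => [|y s IH] Us.
  by have [] := filter_ex Us.
have [Uy|Uny] := in_ultra_setVsetC [set c | f c = y] UU.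
  by exists y => //; exact: mem_head.
have [|z zs Uz] := IH; last by exists z => //; rewrite in_cons zs orbT.
apply: filterS (filterI Us Uny) => c [] /=.
by rewrite in_cons => /orP[/eqP|].
Qed.

(** Matchings of the finite subsystems are put together along an ultrafilter
[U].  As [N i] is finite, the partner of [i] is constant on a set of [U], and
this constant is the partner of [i] in the limit.  Injectivity involves only
two vertices at a time, hence survives. *)
Lemma infinite_hall (I J : choiceType) (N : I -> {fset J}) :
  (forall A, hall_condition N A) ->
  exists f : I -> J, (forall i, f i \in N i) /\ injective f.
Proof.
move=> hallN; have [[i0 _]|noI] := pselect (exists i : I, True); last first.
  have f (i : I) : J by exfalso; apply: noI; exists i.
  by exists f; split=> i; exfalso; apply: noI; exists i.
have [j0 _] : exists j, j \in N i0.
  have := hallN _ _ (fsubset_refl [fset i0]%fset).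
  rewrite cardfs1 cardfs_gt0 => /fset0Pn[j /nbhdP[i /fset1P-> ji]].
  by exists j.
(* Conditions are indexed by pairs of vertices so that each of them involves
   finitely many values of the matching. *)
have [|U [UU UP]] := @ultrafilter_of_finI (I * I)%type (I -> J)
  (fun p => [set c | c p.1 \in N p.1 /\ (c p.1 = c p.2 -> p.1 = p.2)]).
  move=> K; pose A := [fset p.1 | p in K]%fset.
  pose B := [fset p.2 | p in K]%fset.
  have [f [fN finj]] := hall_marriage j0 (hallN (A `|` B)%fset).
  exists f => -[i j] ijK.
  have iA : i \in (A `|` B)%fset by rewrite in_fsetU; apply/orP; left;
    apply/imfsetP; exists (i, j).
  have jB : j \in (A `|` B)%fset by rewrite in_fsetU; apply/orP; right;
    apply/imfsetP; exists (i, j).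
  by split; [exact: fN|exact: finj].
have /choice[f fP] : forall i, exists j, j \in N i /\ U [set c | c i = j].
  move=> i; have [|j jN Uj] := @ultrafilter_seq _ _ U (fun c => c i) (N i) UU.
    by apply: filterS (UP (i, i)) => c [].
  by exists j.
exists f; split=> [i|i j fij]; first by have [] := fP i.
have [_ Ui] := fP i; have [_ Uj] := fP j.
have [c [[ci cj] [_ /= cij]]] :=
  filter_ex (filterI (filterI Ui Uj) (UP (i, j))).
by apply: cij; rewrite ci cj.
Qed.

(** * Images of finite sets under partial bijections *)

Section Reach.
Variable X : choiceType.
Implicit Types (s t f g h : pbij X) (K L : seq (pbij X)) (F : {fset X}).

Definition papply s x : option X :=
  if pselect (exists y, graph s (x, y)) is left sx then Some (projT1 (cid sx))
  else None.

Lemma papplyP s x y : papply s x = Some y <-> graph s (x, y).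
Proof.
rewrite /papply; case: pselect => [sx|nsx]; last first.
  by split=> // sxy; case: nsx; exists y.
case: cid => z /= sxz; split=> [[<-]//|sxy].
by rewrite (graph_fun sxz sxy).
Qed.

Definition reach K x : {fset X} := [fset y in pmap (papply^~ x) K]%fset.

Lemma reachP K x y :
  reflect (exists2 s, s \in K & graph s (x, y)) (y \in reach K x).
Proof.
rewrite in_fset /= mem_pmap.
apply: (iffP mapP) => -[s sK sxy]; exists s => //; first exact/papplyP.
by apply/esym/papplyP.
Qed.

Definition sweep K F := nbhd (reach K) F.

Lemma sweepP K F y :
  reflect (exists2 x, x \in F & exists2 s, s \in K & graph s (x, y))
    (y \in sweep K F).
Proof.
by apply: (iffP (nbhdP _ _ _)) => -[x xF] => [/reachP|] sxy; exists x => //;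
  apply/reachP.
Qed.

Fixpoint powers K n :=
  if n is n'.+1 then [seq (s * t)%g | s <- K, t <- powers K n'] else [:: 1%g].

Lemma sweep_powers0 K F : sweep (powers K 0) F = F.
Proof.
apply/fsetP => y; apply/sweepP/idP => [[x xF [s]]|yF].
  by rewrite inE => /eqP-> [_ /= <-].
by exists y => //; exists 1%g; rewrite ?inE.
Qed.

Lemma sweep_powersS K n F :
  sweep (powers K n.+1) F = sweep K (sweep (powers K n) F).
Proof.
apply/fsetP => y; apply/sweepP/sweepP.
  move=> [x xF [_ /allpairsP[[s t] [sK tK ->]]]] [z /= txz szy].
  by exists z; [apply/sweepP; exists x => //; exists t|exists s].
move=> [z /sweepP[x xF [t tK txz]] [s sK szy]].
by exists x => //; exists (s * t)%g; [exact: allpairs_f|exists z].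
Qed.

(** A set of partial bijections which enlarges every finite set by the factor
(n + 2) / (n + 1) doubles every finite set after n + 1 rounds, because
(1 + 1 / (n + 1)) ^ (n + 1) is at least 2 by Bernoulli's inequality. *)
Lemma expansion_doubling K n :
  (forall F, n.+2 * #|` F| <= n.+1 * #|` sweep K F|)%N ->
  forall F, (2 * #|` F| <= #|` sweep (powers K n.+1) F|)%N.
Proof.
move=> expK F.
have grow k : (n.+2 ^ k * #|` F| <= n.+1 ^ k * #|` sweep (powers K k) F|)%N.
  elim: k => [|k IH]; first by rewrite sweep_powers0.
  rewrite sweep_powersS !expnS.
  rewrite (leq_trans (n := n.+2 * (n.+1 ^ k * #|` sweep (powers K k) F|)))//.
    by rewrite -mulnA leq_mul2l IH orbT.
  by rewrite mulnCA [(n.+1 * _)%N]mulnC -mulnA leq_mul2l expK orbT.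
have bern : (2 * n.+1 ^ n.+1 <= n.+2 ^ n.+1)%N.
  have bernoulli k : (n.+1 ^ k + k * n.+1 ^ k.-1 <= n.+2 ^ k)%N.
    elim: k => [//|k IH]; rewrite [leqRHS]expnS.
    apply: leq_trans (leq_mul (leqnn _) IH).
    case: k {IH} => [|k]; first by rewrite !expn1 expn0 /= mul1n mul0n; lia.
    by rewrite /= !expnS; nia.
  apply: leq_trans (bernoulli n.+1).
  by rewrite /= expnS; lia.
have := leq_trans (leq_mul bern (leqnn #|` F|)) (grow n.+1).
by rewrite -mulnAC mulnC leq_pmul2l ?expn_gt0.
Qed.

End Reach.

(** * Paradoxical decompositions from doubling *)

Section Submonoid.
Variables (X : choiceType) (S : wideInvSubmonoid (pbij X)).
Implicit Types (f g h : pbij X).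

Lemma idempotents_pbijP f :
  idempotents (pbij X) f <-> (forall x y, graph f (x, y) -> x = y).
Proof.
split=> [ff x y fxy|diag].
  have [u /= fxu fuy] : graph (f * f)%g (x, y) by rewrite ff.
  by move: fuy; rewrite -(graph_fun fxy fxu); apply: graph_inj.
apply: pbijP => x y; split=> [[u /= fxu fuy]|fxy].
  by rewrite (diag _ _ fxu).
by exists y => //; rewrite -{1}(diag _ _ fxy).
Qed.

Lemma idempotents_wisP (e : S) :
  idempotents S e <-> (forall x y, graph (wis_val e) (x, y) -> x = y).
Proof.
rewrite -idempotents_pbijP; split=> [ee|ee]; last exact: wis_val_inj.
exact: (congr1 (@wis_val _ S) (ee : (e * e)%g = e)).
Qed.

Lemma wis_id_on (A : set X) : wis_carrier S (pbij_id_on A).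
Proof. by apply: wis_wide; apply/idempotents_pbijP => x y []. Qed.

Lemma natle_graph (a b : S) x y :
  natle a b -> graph (wis_val a) (x, y) -> graph (wis_val b) (x, y).
Proof.
by move=> [e /idempotents_wisP de ->] [u /= /de->].
Qed.

(** Since [h] contains both [f] and [g], these are compatible and have an upper
bound [j] in [S].  The join of [f] and [g] in [S] could a priori be larger than
their union, but the union is the restriction of [j] to the domain of [h], and
restrictions stay in [S] because [S] is wide. *)
Lemma wis_union f g h : distributive_monoid S ->
  wis_carrier S f -> wis_carrier S g ->
  (forall x y, graph h (x, y) <-> graph f (x, y) \/ graph g (x, y)) ->
  wis_carrier S h.
Proof.
move=> [joins _] Sf Sg hfg.
have [|j [fj gj _]] := joins (wis_sub Sf) (wis_sub Sg).
  split; apply/idempotents_wisP => x y [u /= p q].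
    by apply: (@graph_inj _ h _ _ u); apply/hfg; [right|left].
  by apply: (@graph_fun _ h u); apply/hfg; [right|left].
have hj x y : graph h (x, y) -> graph (wis_val j) (x, y).
  by move=> /hfg[?|?]; [apply: natle_graph fj _|apply: natle_graph gj _].
suff -> : h = (wis_val j * pbij_id_on [set x | exists y, graph h (x, y)])%g.
  by apply: wis_mul; [exact: wis_valP|exact: wis_id_on].
apply: pbijP => x y; split=> [hxy|[u /= [[z hxz] <-] jxy]].
  by exists x; [split=> //; exists y|exact: hj].
by rewrite (graph_fun jxy (hj _ _ hxz)).
Qed.

(** Elements of [S] can be cut along arbitrary subsets of [X] and pasted
together again.  Each step of the induction cuts off the part of [h] that agrees with the
first element of [K]; the remaining elements cover the rest of [h]. *)
Lemma wis_piecewise (K : seq (pbij X)) h : distributive_monoid S ->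
  {in K, forall s, wis_carrier S s} ->
  (forall x y, graph h (x, y) -> exists2 s, s \in K & graph s (x, y)) ->
  wis_carrier S h.
Proof.
move=> dS; elim: K h => [|s K IH] h SK hK.
  suff -> : h = pbij_id_on set0 by exact: wis_id_on.
  by apply: pbijP => x y; split=> [/hK[]//|[]].
pose A := [set x | exists2 y, graph h (x, y) & graph s (x, y)].
apply: (@wis_union (s * pbij_id_on A)%g (h * pbij_id_on (~` A))%g) => //.
- by apply: wis_mul; [exact: SK (mem_head _ _)|exact: wis_id_on].
- apply: IH => [t tK|x y [u /= [nAx <-] hxy]].
    by apply: SK; rewrite in_cons tK orbT.
  have [t] := hK _ _ hxy; rewrite in_cons => /orP[/eqP->|tK] txy;
    last by exists t.
  by case: nAx; exists y.
- move=> x y; split=> [hxy|[[u /= [[z hxz sxz] <-] sxy]|[u /= [_ <-]]//]].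
    have [Ax|nAx] := pselect (A x); last by right; exists x.
    left; exists x => //=; case: Ax => z hxz sxz.
    by rewrite (graph_fun hxy hxz).
  by rewrite (graph_fun sxy sxz).
Qed.

Definition graph_of (f : X -> X) (finj : injective f) : pbij X.
Proof.
exists [set xy | f xy.1 = xy.2] => [x y z /= <- //|x y z /= <- /finj //].
Defined.

Lemma strongly_paradoxical_bijections (f g : X -> X) (finj : injective f)
    (ginj : injective g) :
  wis_carrier S (graph_of finj) -> wis_carrier S (graph_of ginj) ->
  (forall x y, f x <> g y) -> (forall y, exists x, f x = y \/ g x = y) ->
  strongly_paradoxical S.
Proof.
move=> Sf Sg fg sur; exists (wis_sub Sf), (wis_sub Sg).
have dom1 (h : X -> X) (hinj : injective h)
    (Sh : wis_carrier S (graph_of hinj)) :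
    dom (wis_sub Sh) = 1%g.
  apply: wis_val_inj; apply: pbijP => x y; split.
    by move=> [u /= <- /hinj <-].
  by move=> [_ /= <-]; exists (h x).
have le1 (h : X -> X) (hinj : injective h)
    (Sh : wis_carrier S (graph_of hinj)) :
    natle (ran (wis_sub Sh)) 1%g.
  exists (ran (wis_sub Sh)); last by rewrite mul1g.
  by apply/idempotents_wisP => x y [u /= <- <-].
split; [exact: dom1|exact: dom1| |split; [exact: le1|exact: le1|]].
  split; apply: wis_val_inj; apply: pbijP => x y; split; try by case.
    by move=> [u /= [v _ gv] [w _ fw]]; case: (fg w v); rewrite fw gv.
  by move=> [u /= [v gv _] [w fw _]]; case: (fg w v); rewrite fw gv.
move=> c fc gc; suff -> : c = 1%g.
  by exists 1%g; [rewrite /idempotents /= mul1g|rewrite mul1g].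
have c1 x : graph (wis_val c) (x, x).
  have [z [fz|gz]] := sur x; [apply: natle_graph fc _|apply: natle_graph gc _];
    by exists z.
apply: wis_val_inj; apply: pbijP => x y; split=> [cxy|[_ /= <-//]].
by split=> //; exact: graph_fun (c1 x) cxy.
Qed.

(** The Schroeder--Bernstein argument.  Let [C] be the set of points missed by
both injections and [D] the union of its iterated images under [f].  Making [f]
the identity on [D] keeps it injective, keeps its range away from that of [g],
and adds exactly [C] to the range, as [D] is the disjoint union of [C] and
the image of [D] by [f]. *)
Lemma strongly_paradoxical_of_injections (f g : X -> X) (finj : injective f)
    (ginj : injective g) : distributive_monoid S ->
  wis_carrier S (graph_of finj) -> wis_carrier S (graph_of ginj) ->
  (forall x y, f x <> g y) -> strongly_paradoxical S.
Proof.
move=> dS Sf Sg fg.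
pose C := [set y | forall x, f x <> y /\ g x <> y].
pose D := [set y | exists n c, C c /\ y = iter n f c].
have fD x : D (f x) <-> D x.
  split=> [[[|n] [c [Cc]]]|[n [c [Cc ->]]]].
  - by move=> /= fx; have [] := Cc x.
  - by move=> /= /finj->; exists n, c.
  - by exists n.+1, c.
have gD x : ~ D (g x).
  move=> [[|n] [c [Cc]]] /= gx; first by have [_] := Cc x.
  by apply: fg (esym gx).
pose f' x := if `[< D x >] then x else f x.
have f'inj : injective f'.
  move=> x y; rewrite /f'; case: asboolP => Dx; case: asboolP => Dy //;
    last exact: finj.
    by move=> xfy; case: Dy; apply/fD; rewrite -xfy.
  by move=> fxy; case: Dx; apply/fD; rewrite fxy.
apply: (@strongly_paradoxical_bijections f' g f'inj ginj) => //.
- apply: (@wis_piecewise [:: 1%g; graph_of finj]) => //.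
    move=> s; rewrite !inE => /orP[/eqP->|/eqP->//]; exact: wis_one.
  move=> x y /=; rewrite /f'; case: asboolP => Dx.
    by move=> <-; exists 1%g; rewrite ?inE ?eqxx.
  by exists (graph_of finj); rewrite ?inE ?eqxx ?orbT.
- move=> x y; rewrite /f'; case: asboolP => Dx // xg.
  by apply: (gD y); rewrite -xg.
- move=> y; have [Dy|nDy] := pselect (D y).
    by exists y; left; rewrite /f' asboolT.
  have [x xy] : exists x, f x = y \/ g x = y.
    apply: contrapT => nex; apply: nDy; exists 0, y; split=> // x.
    by split=> e; apply: nex; exists x; [left|right].
  exists x; case: xy => [fx|]; last by right.
  by left; rewrite /f' asboolF// => Dx; apply: nDy; rewrite -fx; apply/fD.
Qed.

(** Doubling is Hall's condition for the bipartite graph that joins two copies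
of each point [x] to the finitely many points that [L] reaches from [x].  A
matching gives one injection for each copy, with disjoint ranges, and each of
them is piecewise in [L]. *)
Lemma strongly_paradoxical_of_doubling (L : seq (pbij X)) :
  distributive_monoid S -> {in L, forall s, wis_carrier S s} ->
  (forall F, (2 * #|` F| <= #|` sweep L F|)%N) -> strongly_paradoxical S.
Proof.
move=> dS SL dbl.
have [|phi [phiL phi_inj]] :=
    @infinite_hall (X * bool)%type X (fun p => reach L p.1).
  move=> _ B _; pose F := [fset p.1 | p in B]%fset.
  have -> : nbhd (fun p : X * bool => reach L p.1) B = sweep L F.
    apply/fsetP => y; apply/nbhdP/nbhdP => [[[x b] xbB yx]|].
      by exists x => //; apply/imfsetP; exists (x, b).
    by move=> [_ /imfsetP[p pB ->] yp]; exists p.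
  apply: leq_trans (dbl F); rewrite mul2n -addnn.
  apply: (@leq_trans
    #|` [fset (x, true) | x in F] `|` [fset (x, false) | x in F]|%fset).
    apply: fsubset_leq_card; apply/fsubsetP => -[x b] xB.
    have xF : x \in F by apply/imfsetP; exists (x, b).
    rewrite in_fsetU; apply/orP; case: b {xB}; [left|right];
      by apply/imfsetP; exists x.
  by apply: leq_trans (leq_card_fsetU _ _) _; apply: leq_add;
    exact: leq_imfset_card.
have inj b : injective (fun x => phi (x, b)) by move=> x y /phi_inj[].
have Sphi b : wis_carrier S (graph_of (inj b)).
  apply: (wis_piecewise dS SL) => x y /= <-; exact/reachP/(phiL (x, b)).
apply: (strongly_paradoxical_of_injections dS (Sphi true) (Sphi false)).
by move=> x y /phi_inj.
Qed.

End Submonoid.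

(** * Almost invariant finite sets *)

Section Folner.
Variables (X : choiceType) (S : wideInvSubmonoid (pbij X)).
Implicit Types (s : pbij X) (F : {fset X}) (A B : set X).

Definition almost_invariant s m F :=
  F != fset0 /\ (m * #|` (sweep [:: s] F `\` F)%fset| <= #|` F|)%N.

(** Otherwise the finite set [L], made of 1 and of the elements of [S] that
occur in [K], would enlarge every nonempty finite set by a fixed factor,
and so a power of [L] would double every finite set.  With 1 in [L], the set [F]
is part of [sweep L F], so a bound on the latter bounds what lies outside
[F]. *)
Lemma exists_almost_invariant (K : {fset pbij X * nat}) :
  (forall L : seq (pbij X), {in L, forall s, wis_carrier S s} ->
     ~ forall F, (2 * #|` F| <= #|` sweep L F|)%N) ->
  exists F, {in K, forall p, wis_carrier S p.1 -> almost_invariant p.1 p.2 F}.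
Proof.
move=> nodbl.
pose L := 1%g :: [seq p.1 | p <- K & `[< wis_carrier S p.1 >]].
pose n := \max_(p <- K) p.2.
have LS s : s \in L -> wis_carrier S s.
  rewrite in_cons => /orP[/eqP->|/mapP[p]]; first exact: wis_one.
  by rewrite mem_filter => /andP[/asboolP Sp _] ->.
have powS k s : s \in powers L k -> wis_carrier S s.
  elim: k s => [|k IH] s; first by rewrite inE => /eqP->; exact: wis_one.
  by move=> /allpairsP[[t u] /= [/LS tS /IH uS ->]]; exact: wis_mul.
have [F F0 small] : exists2 F, F != fset0 &
    (n.+1 * #|` sweep L F| < n.+2 * #|` F|)%N.
  apply: contrapT => noF; apply: (nodbl (powers L n.+1)); first exact: powS.
  apply: expansion_doubling => F; rewrite leqNgt; apply/negP => lt; apply: noF.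
  exists F => //; apply: contraTneq lt => ->.
  by rewrite cardfs0 muln0.
exists F => -[s m] sK /= Ss; split=> //.
have FL : (F `<=` sweep L F)%fset.
  apply/fsubsetP => x xF; apply/sweepP; exists x => //.
  by exists 1%g; [exact: mem_head|].
have sub : (sweep [:: s] F `\` F `<=` sweep L F `\` F)%fset.
  apply: fsetSD; apply/fsubsetP => y /sweepP[x xF [t]].
  rewrite inE => /eqP-> sxy; apply/sweepP; exists x => //; exists s => //.
  rewrite in_cons; apply/orP; right; apply/mapP; exists (s, m) => //.
  by rewrite mem_filter sK andbT; apply/asboolP.
have mn : (m <= n)%N by exact: (@leq_bigmax_seq _ _ xpredT snd (s, m) sK isT).
have := fsubset_leq_card sub; rewrite (cardfsDS FL).
move=> /(leq_mul mn)/leq_trans; apply.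
have := fsubset_leq_card FL; move: small; rewrite mulnBr !mulSn; lia.
Qed.

Definition card_on A F := #|` [fset x in F | `[< A x >]]%fset|.

Lemma card_on_le A F : (card_on A F <= #|` F|)%N.
Proof.
by apply: fsubset_leq_card; apply/fsubsetP => x; rewrite !inE => /andP[].
Qed.

Lemma card_onT F : card_on setT F = #|` F|.
Proof.
rewrite /card_on; congr #|` _|; apply/fsetP => x.
by rewrite !inE asboolT ?andbT.
Qed.

Lemma card_onU A B F : A `&` B = set0 ->
  card_on (A `|` B) F = (card_on A F + card_on B F)%N.
Proof.
move=> AB0; rewrite /card_on -cardfsUI [X in (_ + X)%N](_ : _ = 0%N) ?addn0.
  congr #|` _|; apply/fsetP => x; rewrite !inE -andb_orr asbool_or.
  by [].
apply/eqP; rewrite cardfs_eq0; apply/eqP/fsetP => x; rewrite !inE.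
apply/negP => /andP[/andP[_ /asboolP Ax] /andP[_ /asboolP Bx]].
by have : (A `&` B) x by []; rewrite AB0.
Qed.

Definition pdom s : set X := [set x | exists y, graph s (x, y)].

(** The injection [s] sends the points of [F] in its domain to points of its
range, and the images that leave [F] are counted by the last term. *)
Lemma card_on_pdom s F :
  (card_on (pdom s) F <=
     card_on (pdom s^-1%g) F + #|` sweep [:: s] F `\` F|%fset)%N.
Proof.
pose f x := odflt x (papply s x).
have fP x : pdom s x -> graph s (x, f x).
  by case=> y sxy; rewrite /f; move/papplyP: (sxy) => ->.
rewrite /card_on; set D := [fset x in F | `[< pdom s x >]]%fset.
have <- : #|` (f @` D)%fset| = #|` D|.
  rewrite card_in_imfset// => x y.
  rewrite !inE => /andP[_ /asboolP/fP sx] /andP[_ /asboolP/fP sy] fxy.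
  by apply: graph_inj sx _; rewrite fxy.
apply: leq_trans (leq_card_fsetU _ _); apply: fsubset_leq_card.
apply/fsubsetP => y /imfsetP[x /=]; rewrite !inE => /andP[xF /asboolP/fP sx] ->.
have [yF|yF] /= := boolP (f x \in F); last first.
  apply/sweepP; exists x => //.
  by exists s; rewrite ?inE.
by apply/orP; left; apply/asboolP; exists x.
Qed.
End Folner.

(** * The mean along an ultrafilter *)

Section Mean.
Variables (R : realType) (X : choiceType) (S : wideInvSubmonoid (pbij X)).
Variables (U : set_system {fset X}).
Hypothesis UU : UltraFilter U.
Hypothesis UF : forall s m,
  wis_carrier S s -> U [set F | almost_invariant s m F].
Implicit Types (A B : set X) (F : {fset X}).
Local Open Scope ring_scope.

Let U0 : U [set F : {fset X} | F != fset0].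
Proof. by apply: filterS (UF 0 (wis_one S)) => F []. Qed.

Definition freq A F : R := (card_on A F)%:R / #|` F|%:R.

Lemma freq_ge0 A F : 0 <= freq A F.
Proof. by rewrite divr_ge0 ?ler0n. Qed.

Lemma freq_le1 A F : freq A F <= 1.
Proof.
rewrite /freq; have [->|F0] := eqVneq #|` F| 0%N.
  by rewrite invr0 mulr0 ler01.
by rewrite ler_pdivrMr ?ltr0n ?lt0n// mul1r ler_nat card_on_le.
Qed.

Lemma cvg_freq A : cvg (freq A @ U).
Proof.
have [|p [_ clp]] := @segment_compact R 0 1 (freq A @ U) _.
  by apply: (@filterE _ U) => F; rewrite /= in_itv /= freq_ge0 freq_le1.
apply/cvg_ex; exists p => B Bp.
have [//|UnB] := in_ultra_setVsetC (freq A @^-1` B) UU.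
by have [x []] := clp (~` B) B UnB Bp.
Qed.

(** The mean is defined on all subsets of [X]; as [S] is wide, these are
the idempotents of [S]. *)
Definition mean A : R := lim (freq A @ U).

Lemma mean_ge0 A : 0 <= mean A.
Proof.
by apply: limr_ge; [exact: cvg_freq|apply: filterE => F; exact: freq_ge0].
Qed.

Lemma meanT : mean setT = 1.
Proof.
apply: cvg_lim => //; apply: cvg_near_cst.
apply: filterS U0 => F F0; rewrite /freq card_onT divff//.
by rewrite pnatr_eq0 cardfs_eq0.
Qed.

Lemma meanU A B : A `&` B = set0 -> mean (A `|` B) = mean A + mean B.
Proof.
move=> AB0; apply: cvg_lim => //.
suff -> : freq (A `|` B) = freq A \+ freq B by apply: cvgD; exact: cvg_freq.
by apply/funext => F /=; rewrite /freq card_onU// natrD mulrDl.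
Qed.

(** Along [U] the frequency of the domain of [s] exceeds that of its range by at
most 1 / m, for every m, as the sets are eventually almost invariant for [s] up
to 1 / m. *)
Lemma mean_pdom_le s : wis_carrier S s -> mean (pdom s) <= mean (pdom s^-1%g).
Proof.
move=> Ss; rewrite leNgt; apply/negP => /ltr_add_invr[m].
rewrite ltNge => /negP; apply.
have -> : mean (pdom s) = mean (pdom s^-1%g)
    + lim ((freq (pdom s) \- freq (pdom s^-1%g)) @ U).
  by rewrite limB; [rewrite subrKC|exact: cvg_freq|exact: cvg_freq].
rewrite lerD2l; apply: limr_le; first by apply: is_cvgB; exact: cvg_freq.
apply: filterS (UF m.+1 Ss) => F [F0 inv] /=; rewrite lerBlDl.
have F0' : (0 < #|` F|%:R :> R) by rewrite ltr0n cardfs_gt0.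
rewrite /freq ler_pdivrMr// mulrDl divfK ?gt_eqF//.
apply: (@le_trans _ _
  ((card_on (pdom s^-1%g) F)%:R + #|` sweep [:: s] F `\` F|%fset%:R)).
  by rewrite -natrD ler_nat card_on_pdom.
by rewrite lerD2l mulrC ler_pdivlMr ?ltr0n// -natrM ler_nat mulnC.
Qed.

Lemma mean_pdomV s : wis_carrier S s -> mean (pdom s) = mean (pdom s^-1%g).
Proof.
move=> Ss; apply/eqP; rewrite eq_le mean_pdom_le//=.
by rewrite -{2}(invgK s) mean_pdom_le//; exact: wis_inv.
Qed.

Lemma invariant_mean_mean :
  invariant_mean (fun e : idempotents S => mean (pdom (wis_val (\val e)))).
Proof.
have diag (e : idempotents S) x y : graph (wis_val (\val e)) (x, y) -> x = y.
  by move: x y; apply/idempotents_wisP; exact: set_mem (valP e).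
have dom_diag (e : idempotents S) x :
    pdom (wis_val (\val e)) x <-> graph (wis_val (\val e)) (x, x).
  by split=> [[y exy]|]; [rewrite {2}(diag _ _ _ exy)|exists x].
split.
- by move=> e; exact: mean_ge0.
- move=> s e f es fs; have -> : pdom (wis_val (\val e)) = pdom (wis_val s).
    rewrite es; apply/seteqP; split=> x [y].
      by move=> [u sxu _]; exists u.
    by move=> sxy; exists x; exists y.
  have -> : pdom (wis_val (\val f)) = pdom (wis_val s)^-1%g.
    rewrite fs; apply/seteqP; split=> x [y].
      by move=> [u sxu _]; exists u.
    by move=> sxy; exists x; exists y.
  by apply: mean_pdomV; exact: wis_valP.
- move=> e f g [ef0 _] [eg fg gmin]; rewrite -meanU.
    congr mean; apply/seteqP; split=> x; last first.
      by move=> [] [y exy]; exists y;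
        [exact: natle_graph eg exy|exact: natle_graph fg exy].
    (* The join [g] lies below every upper bound, in particular below the
       identity of the union [A] of the two domains. *)
    pose A := pdom (wis_val (\val e)) `|` pdom (wis_val (\val f)).
    have le (h : idempotents S) : pdom (wis_val (\val h)) `<=` A ->
        natle (\val h) (wis_sub (wis_id_on S A)).
      move=> hA; exists (\val h); first exact: set_mem (valP h).
      apply: wis_val_inj; apply: pbijP => y z; split=> [hyz|[u /= hyu [Au uz]]].
        exists z => //; split=> //; apply: hA; exists z.
        by rewrite -{1}(diag _ _ _ hyz).
      by rewrite -uz.
    move=> [y gxy].
    have le_gA := gmin _ (le e (@subsetUl _ _ _)) (le f (@subsetUr _ _ _)).
    by have [] := natle_graph le_gA gxy.
  apply/seteqP; split=> // x [/dom_diag exx /dom_diag fxx].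
  suff : graph (wis_val ((\val e)^-1 * \val f)%g) (x, x) by rewrite ef0 => -[].
  by exists x.
- move=> e e1; rewrite -meanT; congr mean; apply/seteqP; split=> // x _.
  by exists x; rewrite e1.
Qed.
End Mean.

Lemma invariant_mean_or_paradoxical (R : realType) (X : choiceType)
    (S : wideInvSubmonoid (pbij X)) : distributive_monoid S ->
  (exists mu : idempotents S -> R, invariant_mean mu) \/ strongly_paradoxical S.
Proof.
move=> dS; have [[L [SL dblL]]|nodbl] := pselect (exists L : seq (pbij X),
    {in L, forall s, wis_carrier S s} /\
    forall F, (2 * #|` F| <= #|` sweep L F|)%N).
  by right; exact: strongly_paradoxical_of_doubling dblL.
left; have [|U [UU UF]] := @ultrafilter_of_finI (pbij X * nat)%type {fset X}
    (fun p => [set F | wis_carrier S p.1 -> almost_invariant p.1 p.2 F]).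
  move=> K; apply: exists_almost_invariant => L SL dblL.
  by apply: nodbl; exists L.
exists (fun e => mean R U (pdom (wis_val (\val e)))).
apply: invariant_mean_mean => s m Ss.
by apply: filterS (UF (s, m)) => F; exact.
Qed.

Theorem theorem3p19 (R : realType) (X : Type) (S : wideInvSubmonoid (pbij X)) :
  infinite_set [set: X] ->
  boolean_monoid S ->
  (exists mu : idempotents S -> R, invariant_mean mu) \/ strongly_paradoxical S.
Proof.
move=> _ [dS _].
(* Finite sets of points require a choice structure on [X]. *)
exact: (@invariant_mean_or_paradoxical R {classic X} S dS).
Qed.
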